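(* Let $0<a,b<\infty$, $\theta=1/2$ and $T>0$. Consider the Dirichlet-Neumann Waveform Relaxation (DNWR) iteration for the one-dimensional heat equation on $(-b,a)\times(0,T)$ with Dirichlet subdomain $\Omega_1=(-b,0)$, Neumann subdomain $\Omega_2=(0,a)$ and initial guess (error) $h^0\in L^\infty(0,T)$ on the interface $x=0$, as described in the context. Then the error $h^k$ on the interface satisfies, for all $k=1,2,3,\dots$, $$\|h^{k}\|_{L^{\infty}(0,T)}\leq\left(\frac{|b-a|}{2b}\right)^{k}\|h^{0}\|_{L^{\infty}(0,T)}.$$ Consequently, if $a<3b$, this is a contraction (the factor $\frac{|b-a|}{2b}$ is less than $1$).
   Context: Model problem: $\partial_t u=\partial_{xx}u+f(x,t)$ for $x\in(-b,a)$, $0<t<T$, with $u(x,0)=u_0(x)$, $u(-b,t)=g(-b,t)$, $u(a,t)=g(a,t)$, where $0<a,b<\infty$. DNWR algorithm with relaxation parameter $\theta\in(0,1]$: given an initial guess $h^0(t)$, $t\in(0,T)$, on the interface $\{x=0\}$, for $k=0,1,2,\dots$ solve first the Dirichlet problem $$\partial_t u_1^{k+1}-\partial_{xx}u_1^{k+1}=f \text{ in } \Omega_1=(-b,0),\quad u_1^{k+1}(x,0)=u_0(x),\quad u_1^{k+1}(-b,t)=g(-b,t),\quad u_1^{k+1}(0,t)=h^k(t),$$ then the problem $$\partial_t u_2^{k+1}-\partial_{xx}u_2^{k+1}=f \text{ in } \Omega_2=(0,a),\quad u_2^{k+1}(x,0)=u_0(x),\quad \partial_x u_2^{k+1}(0,t)=\partial_x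 u_1^{k+1}(0,t),\quad u_2^{k+1}(a,t)=g(a,t),$$ and update $h^{k+1}(t)=\theta u_2^{k+1}(0,t)+(1-\theta)h^k(t)$. Error convention: by linearity, convergence is studied for the errors, i.e. for the homogeneous iteration with $f=0$, $g=0$, $u_0=0$. The exact solution is then $0$, and $h^k$, $u_1^k$, $u_2^k$ denote the errors (so $h^k(t)$ is the error $h^k(t)-u(0,t)$ of the original iteration). Sense of solution: the homogeneous iteration is understood through the Laplace transform in time, $\hat w(s)=\int_0^\infty e^{-st}w(t)\,dt$, $\mathrm{Re}(s)>0$, with $h^0$ extended by zero to $(0,\infty)$ (the values on $(0,T)$ do not depend on the extension). That is, for $\mathrm{Re}(s)>0$, $\hat u_1^{k+1}(\cdot,s)$ solves $s\hat u_1=\partial_{xx}\hat u_1$ on $(-b,0)$ with $\hat u_1(-b,s)=0$, $\hat u_1(0,s)=\hat h^k(s)$; $\hat u_2^{k+1}(\cdot,s)$ solves $s\hat u_2=\partial_{xx}\hat u_2$ on $(0,a)$ with $\partial_x\hat u_2(0,s)=\partial_x\hat u_1^{k+1}(0,s)$, $\hat u_2(a,s)=0$; and $h^{k+1}$ is the function with Laplace transform $\hat h^{k+1}(s)=\theta\hat u_2^{k+1}(0,s)+(1-\theta)\hat h^k(s)$. *)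

(* Defs.v *)
From HB Require Import structures.
From mathcomp Require Import all_boot all_order all_algebra.
From mathcomp Require Import all_classical all_reals all_analysis.
From mathcomp Require Export complex.

Set Implicit Arguments.
Unset Strict Implicit.
Unset Printing Implicit Defensive.

Import Order.TTheory GRing.Theory Num.Theory.
Import numFieldNormedType.Exports.

Local Open Scope classical_set_scope.
Local Open Scope ring_scope.
Local Open Scope complex_scope.

(* Not the [Num] projections 'Re and 'Im, which take values in R[i]. *)
Local Notation Re := complex.Re.
Local Notation Im := complex.Im.

Section ComplexValued.
Context {R : realType}.
Implicit Types (u : R -> R[i]) (z : R[i]) (x : R).

Definition cexp z : R[i] :=
  (expR (Re z))%:C * (cos (Im z) +i* sin (Im z)).

(* Limits, continuity, derivatives and integrals of complex-valued functions
   of a real variable are taken componentwise. *)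
Definition ccvg (F : set_system R) u z : Prop :=
  (Re (u x) @[x --> F] --> Re z) /\ (Im (u x) @[x --> F] --> Im z).

Definition ccontinuous_on (A : set R) u : Prop :=
  {within A, continuous (fun x => Re (u x))} /\
  {within A, continuous (fun x => Im (u x))}.

Definition cderivable u x : Prop :=
  derivable (fun y => Re (u y)) x 1 /\ derivable (fun y => Im (u y)) x 1.

Definition cderive u x : R[i] :=
  derive1 (fun y => Re (u y)) x +i* derive1 (fun y => Im (u y)) x.

Definition cintegral (A : set R) u : R[i] :=
  (\int[lebesgue_measure]_(x in A) Re (u x)) +i*
  (\int[lebesgue_measure]_(x in A) Im (u x)).

Definition diff_quotient u x y : R[i] := (u y - u x) / (y - x)%:C.

Definition left_derivative u x z : Prop := ccvg x^'- (diff_quotient u x) z.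
Definition right_derivative u x z : Prop := ccvg x^'+ (diff_quotient u x) z.

End ComplexValued.

Section DNWR.
Context {R : realType}.
Implicit Types (w : R -> R) (s : R[i]) (a b l r theta T : R).

(* [\_] extends by zero outside `]0, T[. *)
Definition Linfty_norm T w : \bar R :=
  Lnorm lebesgue_measure +oo%E (EFin \o (w \_ `]0, T[)).

Definition has_laplace w : Prop :=
  forall sigma : R, 0 < sigma ->
    lebesgue_measure.-integrable `]0, +oo[
      (fun t => (expR (- sigma * t) * w t)%:E).

Definition laplace w s : R[i] :=
  cintegral `]0, +oo[ (fun t => cexp (- s * t%:C) * (w t)%:C).

Definition transformed_heat s l r (u : R -> R[i]) : Prop :=
  ccontinuous_on `[l, r] u /\
  (forall x, x \in `]l, r[ ->
     [/\ cderivable u x, cderivable (cderive u) x &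
         s * u x = cderive (cderive u) x]).

(* The homogeneous (error) iteration after Laplace transform in time:
   [u1 k s] and [u2 k s] are the functions of x obtained by transforming the
   subdomain errors of the k-th sweep at frequency s.  Only [h k] is kept as a
   function of time; its values at t <= 0 play no role.  The flux at the
   interface is a left derivative for [u1] and a right derivative for [u2]. *)
Definition dnwr_errors a b theta (h : nat -> R -> R)
    (u1 u2 : nat -> R[i] -> R -> R[i]) : Prop :=
  (forall k, has_laplace (h k)) /\
  forall (k : nat) (s : R[i]), 0 < Re s ->
    [/\ [/\ transformed_heat s (- b) 0 (u1 k.+1 s),
            u1 k.+1 s (- b) = 0 &
            u1 k.+1 s 0 = laplace (h k) s],
        transformed_heat s 0 a (u2 k.+1 s),
        exists2 flux : R[i],
          left_derivative (u1 k.+1 s) 0 flux &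
          right_derivative (u2 k.+1 s) 0 flux,
        u2 k.+1 s a = 0 &
        laplace (h k.+1) s =
          theta%:C * u2 k.+1 s 0 + (1 - theta)%:C * laplace (h k) s].

End DNWR.

(* Main.v *)
Require Import Defs.
From mathcomp Require Import all_boot all_order all_algebra.
From mathcomp Require Import all_classical all_reals all_analysis.
From mathcomp Require Import measurable_realfun ess_sup_inf ring lra.

(* Only the real frequencies [s = m + 1] are used.  Write [nabla] for the
   difference operator in [m]; a sequence is completely monotone when all its
   iterated differences are nonnegative.  If [v m'' = (m + 1) v m - kappa], the
   difference [nabla^n v m] solves the same equation with source
   [n nabla^(n-1) v (m + 1)], so the minimum principle and an induction on [n]
   propagate complete monotonicity from the boundary data to the interior.

   Suppose [|h^k| <= M] almost everywhere on the half-line (which holds for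
   [k = 0], as [h^0] is extended by zero), so that [M / s +- h^k] is
   completely monotone, and put [p x = u1 (- x)] and [z = u2 + p], which
   satisfies [z' 0 = 0] and [z 0 = 2 h^(k+1)].
   - If [a <= b], then [z] lives on [[0, a]] with [z a = p a], and one compares
     [p] and [z] with the steady profiles [M (b - x) / b] and [M (b - a) / b].
   - If [b < a], then [p] does not reach [a]; instead [y = - u2] on [[0, a]] and
     [q = - z] on [[0, b]] satisfy [y 0 = q 0 + h^k], [q b = y b], [y a = 0]
     and [q' 0 = 0], a nonlocal problem that still has a minimum principle; the
     steady profiles are [M (a - x) / b] and [M (a - b) / b].
   Either way [|b - a| / (2 b) M / s +- h^(k+1)] is completely monotone.  By
   Hausdorff's moment theorem in the variable [exp (- t)] this means
   [|h^(k+1)| <= |b - a| / (2 b) M] almost everywhere. *)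

Set Implicit Arguments.
Unset Strict Implicit.
Unset Printing Implicit Defensive.

Import Order.TTheory GRing.Theory Num.Theory.
Import numFieldNormedType.Exports.
Local Open Scope classical_set_scope.
Local Open Scope ring_scope.

(** * Minimum principles *)

Section MinimumPrinciple.
Context {R : realType}.
Implicit Types (s l r c x y : R) (S v d e : R -> R).

(** The equation [s v - v'' = S], with [d] the first derivative. It says nothing about derivatives
    at the end points, so flux conditions are stated apart, as limits of difference quotients. *)
Definition resolvent s l r S v :=
  {within `[l, r], continuous v} /\
  exists d, forall x, x \in `]l, r[ ->
    is_derive x 1 v (d x) /\ is_derive x 1 d (s * v x - S x).

(** As [e < 0], the slope [d] strictly decreases; flatness at [c] then forces it to be negative, and
    the mean value theorem concludes. *)
Lemma concave_lt_flat_point v d e c c' :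
  {within `[c, c'], continuous v} ->
  (forall x, x \in `]c, c'[ -> is_derive x 1 v (d x)) ->
  (forall x, x \in `]c, c'[ -> is_derive x 1 d (e x)) ->
  (forall x, x \in `]c, c'[ -> e x < 0) ->
  (v y - v c) / (y - c) @[y --> c^'+] --> 0 ->
  forall x, x \in `]c, c'[ -> v x < v c.
Proof.
move=> cv dv dd e_lt0 v'0.
have sub x y : x \in `]c, c'[ -> y \in `]c, c'[ -> {subset `[x, y] <= `]c, c'[}.
  by move=> /itvP xc /itvP yc; apply: subitvP; rewrite subitvE !bnd_simp xc yc.
have d_decr x y : x \in `]c, c'[ -> y \in `]c, c'[ -> x < y -> d y < d x.
  move=> xc yc xy.
  have dxy z : z \in `]x, y[ -> is_derive z 1 d (e z).
    by move=> /subset_itv_oo_cc zxy; apply: dd; exact: sub zxy.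
  have cd : {within `[x, y], continuous d}.
    apply: derivable_within_continuous => z zxy.
    by have [] := dd z (sub _ _ xc yc _ zxy).
  have [z zxy] := MVT xy dxy cd.
  rewrite -subr_lt0 => ->; rewrite nmulr_rlt0 ?subr_gt0//.
  by apply: e_lt0; apply: sub (subset_itv_oo_cc zxy).
have mvt_c y : y \in `]c, c'[ -> exists2 z, z \in `]c, y[ & v y - v c = d z * (y - c).
  move=> yc; have cy : c < y by rewrite (itvP yc).
  have dcy z : z \in `]c, y[ -> is_derive z 1 v (d z).
    by move=> zcy; apply: dv; move: zcy;
      apply: subset_itvl; rewrite bnd_simp ltW// (itvP yc).
  apply: (MVT cy dcy); apply: continuous_subspaceW cv.
  by apply: subset_itvl; rewrite bnd_simp ltW// (itvP yc).
(* If [d x > 0], flatness makes the quotient at some [y] close to [c] smaller than [d x]; but that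
   quotient is [d z] with [z < x], hence larger than [d x]. *)
have d_le0 x : x \in `]c, c'[ -> d x <= 0.
  move=> xc; rewrite leNgt; apply/negP => dx_gt0.
  near c^'+ => y.
  have cy : c < y by near: y; exact: nbhs_right_gt.
  have yx : y < x by near: y; apply: nbhs_right_lt; rewrite (itvP xc).
  have : (v y - v c) / (y - c) < d x by near: y; exact: cvgr_lt v'0 _ dx_gt0.
  have yc : y \in `]c, c'[ by rewrite in_itv/= cy (lt_trans yx) ?(itvP xc).
  have [z zcy ->] := mvt_c _ yc.
  rewrite mulfK ?subr_eq0 ?gt_eqF// ltNge => /negP; apply.
  apply/ltW/d_decr => //; last by rewrite (lt_trans _ yx) ?(itvP zcy).
  by move: zcy; apply: subset_itvl; rewrite bnd_simp ltW// (itvP yc).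
move=> x xc; rewrite -subr_lt0.
have [z zcx ->] := mvt_c _ xc.
have cz : c < z by rewrite (itvP zcx).
have zc' : z < c' by rewrite (lt_trans _ (_ : x < c')) ?(itvP xc) ?(itvP zcx).
rewrite nmulr_rlt0 ?subr_gt0 ?(itvP xc)//.
(* A point to the left of [z], where the slope is at most 0: strict decrease then gives
   [d z < 0]. *)
have mid : (c + z) / 2 \in `]c, c'[ by rewrite in_itv/=; apply/andP; split; lra.
apply: lt_le_trans (d_le0 _ mid); apply: d_decr => //; last by lra.
by rewrite in_itv/= cz.
Unshelve. all: by end_near. Qed.

(** If [v c < 0], continuity keeps [v] negative just to the right of [c], where [v'' = s v - S < 0];
    so [v] drops below [v c]. Only the right side of [c] matters, which also covers a Neumann
    condition at [l]. *)
Lemma resolvent_flat_min s l r S v c :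
  0 < s -> resolvent s l r S v -> (forall x, x \in `]l, r[ -> 0 <= S x) ->
  c \in `[l, r[ -> (v y - v c) / (y - c) @[y --> c^'+] --> 0 ->
  (forall x, x \in `[l, r] -> v c <= v x) -> 0 <= v c.
Proof.
move=> s0 [cv [d dE]] S0 clr v'0 c_min; rewrite leNgt; apply/negP => vc0.
have lc : l <= c by rewrite (itvP clr).
have cr : c < r by rewrite (itvP clr).
have cvr : {within `[c, r], continuous v}.
  by apply: continuous_subspaceW cv; apply: subset_itvr; rewrite bnd_simp.
have [_ vc _] := (continuous_within_itvP v cr).1 cvr.
have := cvgr_lt _ vc _ vc0.
rewrite near_withinE => -[e /= e0 ve].
pose c' := Num.min (c + e) r.
have cc' : c < c' by rewrite lt_min cr ltrDl e0.
have sub : {subset `]c, c'[ <= `]l, r[}.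
  by apply: subitvP; rewrite subitvE !bnd_simp lc ge_min lexx orbT.
have mid : (c + c') / 2 \in `]c, c'[ by rewrite in_itv/=; apply/andP; split; lra.
have midlr := subset_itv_oo_cc (sub _ mid).
suff : v ((c + c') / 2) < v c by rewrite ltNge c_min.
apply: (@concave_lt_flat_point v d (fun x => s * v x - S x) c c' _ _ _ _ v'0) => //.
- apply: continuous_subspaceW cvr; apply: subset_itvl.
  by rewrite bnd_simp ge_min lexx orbT.
- by move=> x /sub /dE[].
- by move=> x /sub /dE[].
- move=> x xc; rewrite subr_lt0; apply: lt_le_trans (S0 _ (sub _ xc)).
  rewrite pmulr_rlt0//; apply: ve; last by rewrite (itvP xc).
  have : x < c' by rewrite (itvP xc).
  have : c < x by rewrite (itvP xc).
  rewrite lt_min => cx /andP[xe _].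
  by rewrite /ball/= ltr0_norm; [lra|rewrite subr_lt0].
Qed.

Lemma resolvent_interior_min s l r S v c :
  0 < s -> resolvent s l r S v -> (forall x, x \in `]l, r[ -> 0 <= S x) ->
  c \in `]l, r[ -> (forall x, x \in `[l, r] -> v c <= v x) -> 0 <= v c.
Proof.
move=> s0 res S0 clr c_min.
apply: (resolvent_flat_min s0 res S0) => //.
  by rewrite in_itv/= ltW ?(itvP clr).
have [_ [d dE]] := res.
have lr : l <= r by rewrite ltW// (itvP clr).
have : is_derive c 1 v 0.
  apply: (derive1_at_min lr) => //.
  - by move=> t /dE[[]].
  - by move=> t /subset_itv_oo_cc; exact: c_min.
(* Turns the vanishing derivative at [c] into the limit of right difference quotients. *)
move=> /is_derive1_caratheodory[g [vg cg g0]].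
rewrite -g0; apply: cvg_trans (cvg_at_right_filter cg).
apply: near_eq_cvg; near=> y.
by rewrite vg mulfK// subr_eq0 gt_eqF//; near: y; exact: nbhs_right_gt.
Unshelve. all: by end_near. Qed.

(** Reduces each minimum principle below to excluding a negative minimum at an end point by means of
    the boundary conditions. *)
Lemma resolvent_neg_min s l r S v : 0 < s -> l < r -> resolvent s l r S v ->
  (forall x, x \in `]l, r[ -> 0 <= S x) ->
  exists2 c, (forall x, x \in `[l, r] -> v c <= v x) &
    0 <= v c \/ c = l \/ c = r.
Proof.
move=> s0 lr res S0.
have [c clr c_min] := EVT_min (ltW lr) res.1.
exists c => //.
have [->|cl] := eqVneq c l; first by auto.
have [->|cr] := eqVneq c r; first by auto.
left; apply: (resolvent_interior_min s0 res S0) => //.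
by rewrite in_itv/= !lt_neqAle eq_sym cl cr !(itvP clr).
Qed.

Lemma dirichlet_ge0 s l r S v : 0 < s -> l < r -> resolvent s l r S v ->
  (forall x, x \in `]l, r[ -> 0 <= S x) -> 0 <= v l -> 0 <= v r ->
  forall x, x \in `[l, r] -> 0 <= v x.
Proof.
move=> s0 lr res S0 vl vr x xlr.
have [c c_min cP] := resolvent_neg_min s0 lr res S0.
apply: le_trans (c_min _ xlr).
by case: cP => [//|[->|->]].
Qed.

Lemma neumann_ge0 s l r S v : 0 < s -> l < r -> resolvent s l r S v ->
  (forall x, x \in `]l, r[ -> 0 <= S x) ->
  (v y - v l) / (y - l) @[y --> l^'+] --> 0 -> 0 <= v r ->
  forall x, x \in `[l, r] -> 0 <= v x.
Proof.
move=> s0 lr res S0 v'0 vr x xlr.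
have [c c_min cP] := resolvent_neg_min s0 lr res S0.
apply: le_trans (c_min _ xlr).
case: cP => [//|[cl|->//]]; rewrite cl in c_min *.
by apply: (resolvent_flat_min s0 res S0 _ v'0) => //; rewrite in_itv/= lexx.
Qed.

(* A negative minimum of [y] could only sit at [0]; then [q 0 <= y 0 < 0], the
   minimum of [q] sits at [b], and [y b = q b <= y 0] would be an interior
   minimum of [y]. *)
Lemma nonlocal_ge0 s (a b : R) (Sy Sq y q : R -> R) : 0 < s -> 0 < b < a ->
  resolvent s 0 a Sy y -> resolvent s 0 b Sq q ->
  (forall x, x \in `]0, a[ -> 0 <= Sy x) ->
  (forall x, x \in `]0, b[ -> 0 <= Sq x) ->
  (q x - q 0) / (x - 0) @[x --> 0^'+] --> 0 ->
  q b = y b -> q 0 <= y 0 -> 0 <= y a ->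
  (forall x, x \in `[0, a] -> 0 <= y x) /\
  (forall x, x \in `[0, b] -> 0 <= q x).
Proof.
move=> s0 /andP[b0 ba] resy resq Sy0 Sq0 q'0 qb q0 ya.
have a0 : 0 < a by exact: lt_trans ba.
have b0a : b \in `[0, a] by rewrite in_itv/= !ltW.
suff y_ge0 x : x \in `[0, a] -> 0 <= y x.
  split=> //; apply: (neumann_ge0 s0 b0 resq) => //.
  by rewrite qb y_ge0.
move=> xa.
have [c c_min cP] := resolvent_neg_min s0 a0 resy Sy0.
apply: le_trans (c_min _ xa); case: cP => [//|[c0|->//]].
rewrite c0 in c_min *.
rewrite leNgt; apply/negP => y0_lt0.
have [c2 c2_min c2P] := resolvent_neg_min s0 b0 resq Sq0.
have qc2 : q c2 <= y 0.
  by apply: le_trans q0; apply: c2_min; rewrite in_itv/= lexx ltW.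
have := le_lt_trans qc2 y0_lt0.
rewrite ltNge => /negP; apply; case: c2P => [//|[c20|c2b]].
  rewrite c20 in c2_min *.
  by apply: (resolvent_flat_min s0 resq Sq0 _ q'0) => //; rewrite in_itv/= lexx.
rewrite c2b qb in qc2 *.
apply: (resolvent_interior_min s0 resy Sy0).
  by rewrite in_itv/= b0.
by move=> t ta; apply: le_trans qc2 _; exact: c_min.
Qed.

Lemma eq_resolvent s l r S S' v v' : S =1 S' -> v =1 v' ->
  resolvent s l r S v -> resolvent s l r S' v'.
Proof. by move=> /funext -> /funext ->. Qed.

Lemma resolvent_sub s l r l' r' S v : l <= l' -> r' <= r ->
  resolvent s l r S v -> resolvent s l' r' S v.
Proof.
move=> ll rr [cv [d dE]]; split.
  apply: continuous_subspaceW cv => /=.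
  by apply: subitvP; rewrite subitvE !bnd_simp ll rr.
exists d => x xlr; apply: dE; move: x xlr.
by apply: subitvP; rewrite subitvE !bnd_simp ll rr.
Qed.

(** The two frequencies may differ: the mismatch [s' - s] moves into the source. For consecutive
    frequencies and [k = -1] this gives the source created by [nabla]. *)
Lemma resolvent_lincomb s s' l r (k : R) S S' v v' :
  resolvent s l r S v -> resolvent s' l r S' v' ->
  resolvent s l r (fun x => S x + k * S' x - k * (s' - s) * v' x)
                  (fun x => v x + k * v' x).
Proof.
move=> [cv [d dE]] [cv' [d' dE']]; split.
  apply: within_continuousD => // x.
  by apply: cvgM; [exact: cvg_cst|exact: cv'].
exists (fun x => d x + k * d' x) => x xlr.
have [dv dd] := dE _ xlr; have [dv' dd'] := dE' _ xlr.
split; first by apply: is_deriveD; exact: is_deriveZ.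
rewrite [X in is_derive _ _ _ X](_ : _ =
    s * v x - S x + k * (s' * v' x - S' x)); last by ring.
by apply: is_deriveD; exact: is_deriveZ.
Qed.

Lemma resolvent_affine s l r (u w : R) :
  resolvent s l r (fun x => s * (u + w * x)) (fun x => u + w * x).
Proof.
have dE x : is_derive x 1 (fun x => u + w * x) w.
  rewrite [X in is_derive _ _ _ X](_ : _ = 0 + w * 1); last by rewrite add0r mulr1.
  apply: is_deriveD; apply: is_deriveZ; exact: is_derive_id.
split.
  by apply: derivable_within_continuous => x _; have [] := dE x.
by exists (fun=> w) => x _; split => //; rewrite subrr; exact: is_derive_cst.
Qed.

Lemma resolvent_reflect s l r S v : resolvent s (- r) (- l) S v ->
  resolvent s l r (fun x => S (- x)) (fun x => v (- x)).
Proof.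
move=> [cv [d dE]]; split; first exact: within_continuous_compN.
exists (fun x => - d (- x)) => x xlr.
have [|dv dd] := dE (- x).
  by rewrite in_itv/= !ltrN2 !(itvP xlr).
split.
  by rewrite -mulrN1; exact: (@is_derive1_comp _ v -%R _ _ _ dv (is_deriveNid _ _)).
have := @is_derive1_comp _ d -%R _ _ _ dd (is_deriveNid _ _).
by move=> /is_deriveN; rewrite mulrN1 opprK.
Qed.

End MinimumPrinciple.

(** * Completely monotone sequences *)

Section CompletelyMonotone.
Context {R : realType}.
Implicit Types (f g : nat -> R).

Definition nabla f (m : nat) : R := f m - f m.+1.

Definition cm f : Prop := forall n m, 0 <= iter n nabla f m.

Lemma eq_cm f g : f =1 g -> cm f -> cm g.
Proof. by move=> /funext ->. Qed.

Lemma iter_nablaZ (c : R) f n m :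
  iter n nabla (fun i => c * f i) m = c * iter n nabla f m.
Proof. by elim: n m => //= n IH m; rewrite /nabla !IH mulrBr. Qed.

Lemma iter_nablaD f g n m :
  iter n nabla (fun i => f i + g i) m = iter n nabla f m + iter n nabla g m.
Proof. by elim: n m => //= n IH m; rewrite /nabla !IH; ring. Qed.

Lemma cmZ (c : R) f : 0 <= c -> cm f -> cm (fun m => c * f m).
Proof. by move=> c0 cmf n m; rewrite iter_nablaZ mulr_ge0. Qed.

Lemma iter_nabla0 n m : iter n nabla (fun=> 0) m = 0.
Proof. by elim: n m => //= n IH m; rewrite /nabla !IH subrr. Qed.

Implicit Types (v p q y z : nat -> R -> R) (kappa : R -> R).

(* Differencing [v m'' = (m+1) v m - kappa] in [m] creates the source
   [n nabla^(n-1) v (m+1)], whose sign is known by induction on [n]. *)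
Lemma resolvent_iter_nabla (l r : R) kappa v :
  (forall m, resolvent m.+1%:R l r kappa (v m)) ->
  forall n m, resolvent m.+1%:R l r
    (fun x => if n is n'.+1 then n%:R * iter n' nabla (v^~ x) m.+1 else kappa x)
    (fun x => iter n nabla (v^~ x) m).
Proof.
move=> res; elim => [|n IH] m; first exact: res.
have := resolvent_lincomb (-1) (IH m) (IH m.+1).
apply: eq_resolvent => x; last by rewrite mulN1r.
case: n {IH} => [|n] /=; rewrite /nabla.
  by rewrite -[m.+2%:R]natr1; ring.
by rewrite -[m.+2%:R]natr1 -[n.+2%:R]natr1; ring.
Qed.

Lemma iter_nabla_flat (l : R) v :
  (forall m, (v m x - v m l) / (x - l) @[x --> l^'+] --> 0) ->
  forall n m, (iter n nabla (v^~ x) m - iter n nabla (v^~ l) m) / (x - l)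
     @[x --> l^'+] --> 0.
Proof.
move=> flat; elim => [|n IH] m; first exact: flat.
rewrite (@eq_cvg _ _ _ _
  ((fun x => (iter n nabla (v^~ x) m - iter n nabla (v^~ l) m) / (x - l)) \-
   (fun x => (iter n nabla (v^~ x) m.+1 - iter n nabla (v^~ l) m.+1) / (x - l)))).
  by have := cvgB (IH m) (IH m.+1); rewrite subrr; exact.
by move=> x /=; rewrite /nabla; ring.
Qed.

Lemma source_ge0 (l r : R) kappa v n m :
  (forall x, x \in `[l, r] -> 0 <= kappa x) ->
  (forall n' : nat, (n' < n)%N ->
     forall m x, x \in `[l, r] -> 0 <= iter n' nabla (v^~ x) m) ->
  forall x, x \in `]l, r[ ->
  0 <= if n is n'.+1 then n%:R * iter n' nabla (v^~ x) m.+1 else kappa x.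
Proof.
move=> k0 IH x /subset_itv_oo_cc xlr; case: n IH => [_|n IH]; first exact: k0.
by rewrite mulr_ge0// IH.
Qed.

(** First [p] is settled from its Dirichlet data at [0] and [b]; then [z] inherits its value at [a]
    from [p], which is where [a <= b] enters. *)
Lemma cm_local (a b : R) kp kz p z : 0 < a <= b ->
  (forall x, x \in `[0, b] -> 0 <= kp x) ->
  (forall x, x \in `[0, a] -> 0 <= kz x) ->
  (forall m, resolvent m.+1%:R 0 b kp (p m)) ->
  (forall m, resolvent m.+1%:R 0 a kz (z m)) ->
  cm (p^~ 0) -> cm (p^~ b) ->
  (forall m, (z m x - z m 0) / (x - 0) @[x --> 0^'+] --> 0) ->
  (forall m, z m a = p m a) ->
  cm (z^~ 0).
Proof.
move=> /andP[a0 ab] kp0 kz0 resp resz p0 pb z'0 za.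
have b0 : 0 < b by exact: lt_le_trans ab.
have zpa : z^~ a = p^~ a by apply/funext => m; exact: za.
have p_ge0 n : forall m x, x \in `[0, b] -> 0 <= iter n nabla (p^~ x) m.
  elim/ltn_ind: n => n IH m; apply: (dirichlet_ge0 (ltr0Sn _ m) b0).
  - exact: (resolvent_iter_nabla resp n m).
  - exact: source_ge0.
  - exact: p0.
  - exact: pb.
have z_ge0 n : forall m x, x \in `[0, a] -> 0 <= iter n nabla (z^~ x) m.
  elim/ltn_ind: n => n IH m; apply: (neumann_ge0 (ltr0Sn _ m) a0).
  - exact: (resolvent_iter_nabla resz n m).
  - exact: source_ge0.
  - exact: iter_nabla_flat.
  - by rewrite zpa p_ge0// in_itv/= ltW.
by move=> n m; apply: z_ge0; rewrite in_itv/= lexx ltW.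
Qed.

(** Each of [y] and [q] takes a boundary value from the other, so a single induction on the order of
    the difference treats both. *)
Lemma cm_nonlocal (a b : R) ky kq y q : 0 < b < a ->
  (forall x, x \in `[0, a] -> 0 <= ky x) ->
  (forall x, x \in `[0, b] -> 0 <= kq x) ->
  (forall m, resolvent m.+1%:R 0 a ky (y m)) ->
  (forall m, resolvent m.+1%:R 0 b kq (q m)) ->
  cm (fun m => y m 0 - q m 0) -> cm (y^~ a) ->
  (forall m, (q m x - q m 0) / (x - 0) @[x --> 0^'+] --> 0) ->
  (forall m, q m b = y m b) ->
  cm (q^~ 0).
Proof.
move=> /andP[b0 ba] ky0 kq0 resy resq yq0 ya q'0 qb.
have qyb : q^~ b = y^~ b by apply/funext => m; exact: qb.
have yE : y^~ 0 = (fun m => (y m 0 - q m 0) + q m 0).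
  by apply/funext => m; rewrite subrK.
have yq_ge0 n :
  (forall m x, x \in `[0, a] -> 0 <= iter n nabla (y^~ x) m) /\
  (forall m x, x \in `[0, b] -> 0 <= iter n nabla (q^~ x) m).
  elim/ltn_ind: n => n IH.
  suff H m : (forall x, x \in `[0, a] -> 0 <= iter n nabla (y^~ x) m) /\
  (forall x, x \in `[0, b] -> 0 <= iter n nabla (q^~ x) m).
    by split=> m; have [] := H m.
  apply: (nonlocal_ge0 (ltr0Sn _ m) _ (resolvent_iter_nabla resy n m)
                                      (resolvent_iter_nabla resq n m)).
  - by rewrite b0.
  - by apply: source_ge0 => // n' /IH[].
  - by apply: source_ge0 => // n' /IH[].
  - exact: iter_nabla_flat.
  - by rewrite qyb.
  - by rewrite yE iter_nablaD lerDr yq0.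
  - exact: ya.
by move=> n m; apply: (yq_ge0 n).2; rewrite in_itv/= lexx ltW.
Qed.

End CompletelyMonotone.

(** * One sweep of the iteration *)

Section Sweep.
Context {R : realType}.
Implicit Types (a b M : R) (H G : nat -> R) (U : nat -> R -> R).

(* [H] and [G] are the transforms of [h^k] and [h^(k+1)] at [s = m + 1]. *)
Definition sweep a b H G U1 U2 : Prop := forall m : nat,
  [/\ resolvent m.+1%:R (- b) 0 (fun=> 0) (U1 m) /\
        resolvent m.+1%:R 0 a (fun=> 0) (U2 m),
      U1 m (- b) = 0 /\ U1 m 0 = H m,
      exists2 flux : R,
        (U1 m x - U1 m 0) / (x - 0) @[x --> 0^'-] --> flux &
        (U2 m x - U2 m 0) / (x - 0) @[x --> 0^'+] --> flux,
      U2 m a = 0 &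
      2 * G m = U2 m 0 + H m].

(** Lets each one-sided estimate serve for both signs of the error. *)
Lemma sweepN a b H G U1 U2 : sweep a b H G U1 U2 ->
  sweep a b (fun m => - H m) (fun m => - G m)
    (fun m x => - U1 m x) (fun m x => - U2 m x).
Proof.
move=> sw m; have [[res1 res2] [U1b U10] [flux fl fr] U2a HE] := sw m.
have resN l r u : resolvent m.+1%:R l r (fun=> 0) u ->
  resolvent m.+1%:R l r (fun=> 0) (fun x => - u x).
  (* The coefficient comes from [- u = u + (-2) u]. *)
  move=> res; have := resolvent_lincomb (-2) res res.
  by apply: eq_resolvent => x; ring.
split.
- by split; exact: resN.
- by rewrite U1b U10 oppr0.
- exists (- flux).
  + rewrite (@eq_cvg _ _ _ _ (\- (fun x => (U1 m x - U1 m 0) / (x - 0)))); first exact: cvgN.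
    by move=> x /=; ring.
  + rewrite (@eq_cvg _ _ _ _ (\- (fun x => (U2 m x - U2 m 0) / (x - 0)))); first exact: cvgN.
    by move=> x /=; ring.
- by rewrite U2a oppr0.
- by rewrite mulrN HE opprD.
Qed.

(** Reflecting [U1] across the interface reverses its flux, so the sum with [U2] is flat at [0]. *)
Lemma sweep_interface a b H G U1 U2 : sweep a b H G U1 U2 -> forall m,
  [/\ resolvent m.+1%:R 0 b (fun=> 0) (fun x => U1 m (- x)),
   resolvent m.+1%:R 0 a (fun=> 0) (U2 m),
   (((U2 m x + U1 m (- x)) - (U2 m 0 + U1 m 0)) / (x - 0)) @[x --> 0^'+] --> 0 &
   [/\ U1 m (- b) = 0, U1 m 0 = H m, U2 m a = 0 & 2 * G m = U2 m 0 + H m]].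
Proof.
move=> sw m; have [[res1 res2] [U1b U10] [flux fl fr] U2a HE] := sw m.
split=> //.
  by apply: (@resolvent_reflect _ m.+1%:R 0 b (fun=> 0)); rewrite oppr0.
have fl' : (U1 m (- x) - U1 m 0) / (- x - 0) @[x --> 0^'+] --> flux.
  apply/cvg_at_rightNP; rewrite oppr0.
  rewrite (@eq_cvg _ _ _ _ (fun x => (U1 m x - U1 m 0) / (x - 0))).
    exact: fl.
  by move=> x /=; rewrite !opprK subr0 addr0.
rewrite (@eq_cvg _ _ _ _ ((fun x => (U2 m x - U2 m 0) / (x - 0)) \-
   (fun x => (U1 m (- x) - U1 m 0) / (- x - 0)))).
  by have := cvgB fr fl'; rewrite subrr; exact.
by move=> x /=; rewrite !subr0 invrN; ring.
Qed.

Lemma cvg_diff_quotient_shift (v : R -> R) (k : R) :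
  (v x - v 0) / (x - 0) @[x --> 0^'+] --> 0 ->
  ((v x + k) - (v 0 + k)) / (x - 0) @[x --> 0^'+] --> 0.
Proof.
rewrite (@eq_cvg _ _ _ (fun x => ((v x + k) - (v 0 + k)) / (x - 0))
  (fun x => (v x - v 0) / (x - 0)))//.
by move=> x /=; ring.
Qed.

Lemma resolventD_affine (s l r u w : R) (S v : R -> R) : resolvent s l r S v ->
  resolvent s l r (fun x => S x + s * (u + w * x)) (fun x => v x + (u + w * x)).
Proof.
move=> res; have := resolvent_lincomb 1 res (resolvent_affine s l r u w).
by apply: eq_resolvent => x; ring.
Qed.

(** The steady profiles are divided by [s = m + 1]; applying [s] to them yields nonnegative sources
    independent of [m], as [cm_local] requires. *)
Lemma sweep_local a b M H G U1 U2 : 0 < a <= b -> 0 <= M ->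
  sweep a b H G U1 U2 ->
  cm (fun m => M / m.+1%:R + H m) ->
  cm (fun m => (b - a) / (2 * b) * M / m.+1%:R + G m).
Proof.
move=> /[dup] ab0 /andP[a0 ab] M0 /sweep_interface sw cmH.
have b0 : 0 < b by exact: lt_le_trans ab.
have s0 (m : nat) : 1 + m%:R != 0 :> R by rewrite nat1r pnatr_eq0.
pose p m x := U1 m (- x) + (M / m.+1%:R + - (M / b / m.+1%:R) * x).
pose z m x := U2 m x + U1 m (- x) + (M * (b - a) / b / m.+1%:R).
(* [z m 0] is twice the sequence of the conclusion, since [U2 m 0 + U1 m 0 = 2 G m]. *)
suff : cm (z^~ 0).
  move=> /(@cmZ _ 2^-1 _ _) => /(_ ltac:(by rewrite invr_ge0)).
  apply: eq_cm => m; rewrite /z oppr0; have [_ _ _ [_ -> _ <-]] := sw m.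
  by field; rewrite s0 gt_eqF.
apply: (@cm_local _ a b (fun x => M * (b - x) / b) (fun=> M * (b - a) / b) p) => //.
- by move=> x /itvP xb; rewrite divr_ge0 ?mulr_ge0 ?subr_ge0 ?xb// ltW.
- by move=> x _; rewrite divr_ge0 ?mulr_ge0 ?subr_ge0// ltW.
- move=> m; have [res1 _ _ _] := sw m.
  apply: eq_resolvent (resolventD_affine (M / m.+1%:R) (- (M / b / m.+1%:R)) res1) => x.
    by field; rewrite s0 gt_eqF.
  by [].
- move=> m; have [res1 res2 _ _] := sw m.
  have res1a := resolvent_sub (lexx 0) ab res1.
  have := resolventD_affine (M * (b - a) / b / m.+1%:R) 0
    (resolvent_lincomb 1 res2 res1a).
  by apply: eq_resolvent => x; rewrite /z; field; rewrite s0 gt_eqF.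
- apply: eq_cm cmH => m; have [_ _ _ [_ U10 _ _]] := sw m.
  by rewrite /p oppr0 U10; ring.
- apply: eq_cm (_ : cm (fun=> 0)) => m; last by move=> n; rewrite iter_nabla0.
  by have [_ _ _ [U1b _ _ _]] := sw m; rewrite /p U1b; field; rewrite s0 gt_eqF.
- move=> m; have [_ _ flat _] := sw m.
  apply: (@cvg_diff_quotient_shift (fun x => U2 m x + U1 m (- x))).
  have -> : U1 m (- 0) = U1 m 0 by rewrite oppr0.
  exact: flat.
- move=> m; have [_ _ _ [_ _ U2a _]] := sw m.
  by rewrite /z /p U2a; field; rewrite s0 gt_eqF.
Qed.

(** Here [y - q] equals [M / s + H] at [0], while [q] carries [- G]: the sign of the error flips in
    one sweep. At [b] the two profiles agree and [U1] vanishes, so [q = y] there. *)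
Lemma sweep_nonlocal a b M H G U1 U2 : 0 < b < a -> 0 <= M ->
  sweep a b H G U1 U2 ->
  cm (fun m => M / m.+1%:R + H m) ->
  cm (fun m => (a - b) / (2 * b) * M / m.+1%:R - G m).
Proof.
move=> /[dup] ab0 /andP[b0 ba] M0 /sweep_interface sw cmH.
have a0 : 0 < a by exact: lt_trans ba.
have s0 (m : nat) : 1 + m%:R != 0 :> R by rewrite nat1r pnatr_eq0.
pose y m x := - U2 m x + (M * a / b / m.+1%:R + - (M / b / m.+1%:R) * x).
pose q m x := - (U2 m x + U1 m (- x)) + (M * (a - b) / b / m.+1%:R).
suff : cm (q^~ 0).
  move=> /(@cmZ _ 2^-1 _ _) => /(_ ltac:(by rewrite invr_ge0)).
  apply: eq_cm => m; rewrite /q oppr0; have [_ _ _ [_ -> _ <-]] := sw m.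
  by field; rewrite s0 gt_eqF.
apply: (@cm_nonlocal _ a b (fun x => M * (a - x) / b) (fun=> M * (a - b) / b) y) => //.
- by move=> x /itvP xa; rewrite divr_ge0 ?mulr_ge0 ?subr_ge0 ?xa// ltW.
- by move=> x _; rewrite divr_ge0 ?mulr_ge0 ?subr_ge0// ltW.
- move=> m; have [_ res2 _ _] := sw m.
  have := resolventD_affine (M * a / b / m.+1%:R) (- (M / b / m.+1%:R))
    (resolvent_lincomb (-2) res2 res2).
  by apply: eq_resolvent => x; rewrite /y; field; rewrite s0 gt_eqF.
- move=> m; have [res1 res2 _ _] := sw m.
  have res2b := resolvent_sub (lexx 0) (ltW ba) res2.
  have res12 := resolvent_lincomb 1 res1 res2b.
  have := resolventD_affine (M * (a - b) / b / m.+1%:R) 0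
    (resolvent_lincomb (-2) res12 res12).
  by apply: eq_resolvent => x; rewrite /q; field; rewrite s0 gt_eqF.
- apply: eq_cm cmH => m; have [_ _ _ [_ U10 _ _]] := sw m.
  by rewrite /y /q oppr0 U10; field; rewrite s0 gt_eqF.
- apply: eq_cm (_ : cm (fun=> 0)) => m; last by move=> n; rewrite iter_nabla0.
  by have [_ _ _ [_ _ U2a _]] := sw m; rewrite /y U2a; field; rewrite s0 gt_eqF.
- move=> m; have [_ _ flat _] := sw m.
  apply: (@cvg_diff_quotient_shift (fun x => - (U2 m x + U1 m (- x)))).
  have -> : U1 m (- 0) = U1 m 0 by rewrite oppr0.
  rewrite (@eq_cvg _ _ _ _
      (\- (fun x => (U2 m x + U1 m (- x) - (U2 m 0 + U1 m 0)) / (x - 0)))).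
    by have := cvgN flat; rewrite oppr0; exact.
  by move=> x /=; ring.
- move=> m; have [_ _ _ [U1b _ _ _]] := sw m.
  by rewrite /q /y U1b; field; rewrite s0 gt_eqF.
Qed.

Lemma sweep_contraction a b M H G U1 U2 : 0 < a -> 0 < b -> 0 <= M ->
  sweep a b H G U1 U2 ->
  cm (fun m => M / m.+1%:R + H m) -> cm (fun m => M / m.+1%:R - H m) ->
  cm (fun m => `|b - a| / (2 * b) * M / m.+1%:R + G m) /\
  cm (fun m => `|b - a| / (2 * b) * M / m.+1%:R - G m).
Proof.
move=> a0 b0 M0 sw cmp cmn; have [ab|ba] := leP a b.
  rewrite ger0_norm ?subr_ge0//; split.
    by apply: sweep_local sw cmp; rewrite ?a0.
  by apply: sweep_local (sweepN sw) cmn; rewrite ?a0.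
rewrite distrC gtr0_norm ?subr_gt0//; split; last first.
  by apply: sweep_nonlocal sw cmp; rewrite ?b0.
have := sweep_nonlocal _ M0 (sweepN sw) cmn; rewrite b0 => /(_ ba).
by apply: eq_cm => m; rewrite opprK.
Qed.

End Sweep.

(** * Hausdorff's theorem *)

Section Bernstein.
Context {R : realType}.
Implicit Types (N : nat) (phi psi : nat -> R) (x c K alpha beta : R).

(* The Bernstein polynomial [\sum_k 'C(N, k) x^k (1 - x)^(N - k) phi k]. *)
Fixpoint bernstein N phi x : R :=
  if N is N'.+1 then
    x * bernstein N' (fun k => phi k.+1) x + (1 - x) * bernstein N' phi x
  else phi 0%N.

Lemma le_bernstein N phi psi x : 0 <= x <= 1 ->
  (forall k, phi k <= psi k) -> bernstein N phi x <= bernstein N psi x.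
Proof.
move=> /andP[x0 x1]; elim: N phi psi => //= N IH phi psi le.
by rewrite lerD// ler_wpM2l ?subr_ge0// IH.
Qed.

Lemma bernstein_affine N phi x c K :
  bernstein N (fun k => c + K * phi k) x = c + K * bernstein N phi x.
Proof. by elim: N phi => //= N IH phi; rewrite !IH; ring. Qed.

(** Second moment of the binomial law about [c]. The centre is arbitrary because the induction
    replaces [c] by [c - 1]. *)
Lemma bernstein_variance N x c :
  bernstein N (fun k => (k%:R - c) ^+ 2) x = N%:R * x * (1 - x) + (N%:R * x - c) ^+ 2.
Proof.
elim: N c => [|N IH] c /=; first by ring.
rewrite (_ : (fun k => _) = fun k => (k%:R - (c - 1)) ^+ 2); last first.
  by apply/funext => k; rewrite -natr1; ring.
by rewrite !IH -natr1; ring.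
Qed.

(** A Chebyshev-type estimate: [phi] is squeezed between two parabolas centred at the mean [N x],
    whose Bernstein values are explicit. *)
Lemma bernstein_dist N phi x c K : 0 <= x <= 1 ->
  (forall k, `|phi k - c| <= K * (k%:R - N%:R * x) ^+ 2) ->
  `|bernstein N phi x - c| <= K * (N%:R * x * (1 - x)).
Proof.
move=> x01 le; rewrite ler_norml.
have E e : c + e * (N%:R * x * (1 - x)) =
    bernstein N (fun k => c + e * (k%:R - N%:R * x) ^+ 2) x.
  by rewrite bernstein_affine bernstein_variance subrr expr0n addr0.
apply/andP; split; [rewrite lerBrDl -mulNr|rewrite lerBlDl]; rewrite E;
  apply: le_bernstein => // k; have := le k; rewrite ler_norml => /andP[].
  by rewrite lerBrDl mulNr.
by rewrite lerBlDl.
Qed.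

Lemma bernstein_itv01 N phi x : 0 <= x <= 1 -> (forall k, 0 <= phi k <= 1) ->
  0 <= bernstein N phi x <= 1.
Proof.
move=> x01 phi01.
have cst c : bernstein N (fun=> c) x = c.
  by elim: N {phi phi01} => //= N ->; ring.
apply/andP; split; [rewrite -[leLHS](cst 0)|rewrite -[leRHS](cst 1)];
  by apply: le_bernstein => // k; have /andP[] := phi01 k.
Qed.

(** A weak law of large numbers: [k / N] concentrates at [x], and the indicator is constant within
    distance [dlt] of [x]. The error is of order [1 / N]. *)
Lemma bernstein_indic_cvg alpha beta x : 0 <= x <= 1 -> x != alpha -> x != beta ->
  bernstein n.+1 (fun k => (alpha * n.+1%:R < k%:R < beta * n.+1%:R)%R%:R) x
    @[n --> \oo] --> ((alpha < x < beta)%R%:R : R).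
Proof.
move=> /[dup] x01 /andP[x0 x1] xa xb.
pose dlt := Num.min `|x - alpha| `|x - beta|.
have d0 : 0 < dlt by rewrite lt_min !normr_gt0 !subr_eq0 xa xb.
set c := (_ < x < _)%R%:R.
have bound n :
    `|bernstein n.+1 (fun k =>
        (alpha * n.+1%:R < k%:R < beta * n.+1%:R)%R%:R) x - c|
    <= dlt ^- 2 * harmonic n.
  set N := n.+1; have N0 : 0 < N%:R :> R by rewrite ltr0n.
  apply: (@le_trans _ _ ((dlt * N%:R) ^- 2 * (N%:R * x * (1 - x)))); last first.
    rewrite (_ : _ * _ = dlt ^- 2 * (N%:R^-1 * (x * (1 - x)))); last first.
      by field; rewrite !gt_eqF.
    rewrite ler_pM2l ?invr_gt0 ?exprn_gt0// /harmonic /= -/N.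
    by rewrite ler_piMr ?invr_ge0 ?(ltW N0)// mulr_ile1 ?subr_ge0//; lra.
  apply: bernstein_dist => // k.
  have same (y : R) : dlt <= `|x - y| -> `|k%:R - N%:R * x| < dlt * N%:R ->
      ((y * N%:R < k%:R) = (y < x)) * ((k%:R < y * N%:R) = (x < y)).
    move=> dy kx.
    have {}kx : `|k%:R - N%:R * x| < `|x - y| * N%:R.
      by apply: lt_le_trans kx _; rewrite ler_pM2r.
    have [xy|yx|xy] := ltgtP x y.
    - move: kx; rewrite ltr_norml => /andP[_]; rewrite ltr0_norm ?subr_lt0// => kx.
      have {}kx : k%:R < y * N%:R by lra.
      by rewrite kx; split => //; apply/negbTE; rewrite -leNgt ltW.
    - move: kx; rewrite ltr_norml => /andP[+ _]; rewrite gtr0_norm ?subr_gt0// => kx.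
      have {}kx : y * N%:R < k%:R by lra.
      by rewrite kx; split => //; apply/negbTE; rewrite -leNgt ltW.
    - by move: (lt_le_trans d0 dy); rewrite xy subrr normr0 ltxx.
  have [kx|kx] := ltP `|k%:R - N%:R * x| (dlt * N%:R).
    rewrite !(same alpha) ?(same beta) ?ge_min ?lexx ?orbT// subrr normr0.
    by rewrite mulr_ge0 ?sqr_ge0// invr_ge0 sqr_ge0.
  (* Away from the mean the indicators differ by at most 1, while the quadratic bound is at least
     1. *)
  apply: (@le_trans _ _ 1).
    rewrite /c; case: (_ && _); case: (_ && _);
    by rewrite ?subrr ?subr0 ?sub0r ?normrN ?normr1 ?normr0.
  rewrite mulrC ler_pdivlMr ?exprn_gt0 ?mulr_gt0// mul1r -[leRHS]real_normK ?num_real//.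
  by rewrite ler_pXn2r// nnegrE mulr_ge0 ?ltW.
have h0 : dlt ^- 2 * harmonic n @[n --> \oo] --> (0 : R).
  by rewrite -[X in _ --> X](mulr0 (dlt ^- 2)); apply: cvgMl_tmp; exact: cvg_harmonic.
have hN : c - dlt ^- 2 * harmonic n @[n --> \oo] --> c.
  by have := cvgB (cvg_cst c) h0; rewrite subr0; exact.
have hP : c + dlt ^- 2 * harmonic n @[n --> \oo] --> c.
  by have := cvgD (cvg_cst c) h0; rewrite addr0; exact.
apply: squeeze_cvgr hN hP; apply: nearW => n.
by have := bound n; rewrite ler_distl.
Qed.

End Bernstein.

(** * Positivity from moments in the variable [exp (- t)] *)

Section Hausdorff.
Context {R : realType}.
Local Notation mu := (@lebesgue_measure R).
Implicit Types (f : R -> R) (n m N : nat).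

Let D : set R := `]0, +oo[%classic.

Lemma integrable_bounded_mul (A : set R) f (g : R -> R) : measurable A ->
  mu.-integrable A (EFin \o f) -> measurable_fun A g ->
  (forall t, A t -> `|g t| <= 1) -> mu.-integrable A (fun t => (g t * f t)%:E).
Proof.
move=> mA intf mg g1; apply: (@le_integrable _ _ _ mu A mA _ (EFin \o f) _ _ intf).
  apply/measurable_EFinP/measurable_funM => //.
  by have /measurable_EFinP := measurable_int mu intf.
by move=> t At; rewrite /= lee_fin normrM ler_piMl// g1.
Qed.

(** Lebesgue differentiation: almost everywhere [f t] is the derivative of a primitive whose
    increments are the given integrals. The extension [g] by zero makes the primitive available on
    the whole line. *)
Lemma ae_ge0_of_itv f : mu.-integrable D (EFin \o f) ->
  (forall u v : R, 0 <= u -> u < v -> 0 <= \int[mu]_(t in `]u, v[) f t) ->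
  {ae mu, forall t, 0 < t -> 0 <= f t}.
Proof.
move=> intf f_ge0; pose g := f \_ D.
have mD : measurable D by exact: measurable_itv.
have intg : mu.-integrable setT (EFin \o g).
  have := (@integrable_mkcond _ _ _ mu D (EFin \o f) mD).1 intf.
  by rewrite restrict_EFin.
have intgA (A : set R) : measurable A -> mu.-integrable A (EFin \o g).
  by move=> mA; apply: integrableS intg.
have locg : locally_integrable setT g.
  by apply: open_integrable_locally => //; exact: openT.
have := @FTC1 R g (BRight 0) (fun y => intgA _ (measurable_itv _)) locg.
apply: filterS; first exact: (ae_filter_ringOfSetsType mu).
move=> t Ft t0; have /Ft[dF F't] : (BRight 0 < BRight t)%O by rewrite bnd_simp.
have gf : g t = f t by rewrite /g patchE mem_set// /D/= in_itv/= t0.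
rewrite -gf -F't; set F := (fun x : R => _) in dF F't *.
have incF y : t < y -> 0 <= F y - F t.
  move=> ty; rewrite /F Rintegral_itvB ?bnd_simp ?(ltW t0) ?(ltW ty)//; last exact: intgA.
  rewrite -Rintegral_itv_bndo_bndc; last exact: intgA.
  suff -> : \int[mu]_(z in `]t, y[) g z = \int[mu]_(z in `]t, y[) f z.
    exact: f_ge0 (ltW t0) ty.
  apply: eq_Rintegral => z.
  rewrite inE/= in_itv/= => /andP[tz _].
  by rewrite /g patchE mem_set// /D/= in_itv/= (lt_trans t0).
rewrite leNgt; apply/negP => F'_lt0.
have : is_derive t 1 F (F^`()%classic t) by rewrite derive1E; exact/derivableP.
move=> /is_derive1_caratheodory[h [hE ch ht]].
rewrite -ht in F'_lt0.
near t^'+ => y.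
have ty : t < y by near: y; exact: nbhs_right_gt.
have := incF _ ty; rewrite hE pmulr_lge0 ?subr_gt0// leNgt => /negP; apply.
by near: y; exact: (cvgr_lt _ (cvg_at_right_filter ch)).
Unshelve. all: by end_near. Qed.

Lemma measurable_bernstein N phi : measurable_fun setT (@bernstein R N phi).
Proof.
elim: N phi => [|N IH] phi /=; first exact: measurable_cst.
by apply: measurable_funD; apply: measurable_funM => //; exact: measurable_funB.
Qed.

Let X (t : R) : R := expR (- t).

Let X01 t : D t -> 0 <= X t <= 1.
Proof.
by rewrite /D/= in_itv/= andbT => t0; rewrite expR_ge0 -expR0 ler_expR oppr_le0 ltW.
Qed.

Let measurable_X : measurable_fun setT X.
Proof. by apply: measurableT_comp => //; exact: measurable_expR. Qed.

Let mD : measurable D. Proof. exact: measurable_itv. Qed.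

Lemma integrable_pow_bernstein f N phi m n : mu.-integrable D (EFin \o f) ->
  (forall k, 0 <= phi k <= 1) ->
  mu.-integrable D
    (EFin \o (fun t => X t ^+ m * (1 - X t) ^+ n * bernstein N phi (X t) * f t)).
Proof.
move=> intf phi01; apply: integrable_bounded_mul => //.
  apply: measurable_funS (_ : measurable_fun setT _) => //.
  apply: measurable_funM; first apply: measurable_funM.
  - exact: measurable_funX.
  - by apply: measurable_funX; exact: measurable_funB.
  - by apply: measurableT_comp; [exact: measurable_bernstein|exact: measurable_X].
move=> t /X01 /[dup] /(bernstein_itv01 N) /(_ phi01) /andP[b0 b1] /andP[X0 X1].
have Y0 : 0 <= 1 - X t by rewrite subr_ge0.
have Y1 : 1 - X t <= 1 by rewrite gerBl.
rewrite ger0_norm ?mulr_ge0 ?exprn_ge0//.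
by rewrite !mulr_ile1 ?mulr_ge0 ?exprn_ge0 ?exprn_ile1.
Qed.

(** Each unfolding of [bernstein] adds a factor [X] or [1 - X], which is absorbed into the
    exponents; hence the induction is uniform in [m] and [n]. *)
Lemma pow_bernstein_ge0 f : mu.-integrable D (EFin \o f) ->
  (forall m n, 0 <= \int[mu]_(t in D) (X t ^+ m * (1 - X t) ^+ n * f t)) ->
  forall N phi, (forall k, 0 <= phi k <= 1) -> forall m n,
  0 <= \int[mu]_(t in D) (X t ^+ m * (1 - X t) ^+ n * bernstein N phi (X t) * f t).
Proof.
move=> intf f_ge0; elim => [|N IH] phi phi01 m n.
  rewrite (@eq_Rintegral _ _ _ mu _ (fun t => phi 0%N * (X t ^+ m * (1 - X t) ^+ n * f t))).
    rewrite RintegralZl//; first by rewrite mulr_ge0//; have /andP[] := phi01 0%N.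
    have := @integrable_pow_bernstein f 0 (fun=> 1) m n intf.
    rewrite lexx ler01 => /(_ (fun=> isT)); apply: eq_integrable => // t _ /=.
    by rewrite mulr1.
  by move=> t _ /=; ring.
rewrite (@eq_Rintegral _ _ _ mu _ (fun t =>
    X t ^+ m.+1 * (1 - X t) ^+ n * bernstein N (fun k => phi k.+1) (X t) * f t +
    X t ^+ m * (1 - X t) ^+ n.+1 * bernstein N phi (X t) * f t)).
  rewrite RintegralD//; last 2 first.
  - by apply: integrable_pow_bernstein.
  - by apply: integrable_pow_bernstein.
  by rewrite addr_ge0// IH.
by move=> t _ /=; rewrite !exprS; ring.
Qed.

(** Since [X] is decreasing, []u, v[] corresponds to []exp (- v), exp (- u)[]. The Bernstein
    polynomials of that indicator converge to it and stay in [[0, 1]], so dominated convergence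
    carries the sign over to the integral of [f] on []u, v[]. *)
Lemma hausdorff_ae_ge0 f : mu.-integrable D (EFin \o f) ->
  (forall m n, 0 <= \int[mu]_(t in D) (X t ^+ m * (1 - X t) ^+ n * f t)) ->
  {ae mu, forall t, 0 < t -> 0 <= f t}.
Proof.
move=> intf f_ge0; apply: ae_ge0_of_itv => // u v u0 uv.
pose phi n (k : nat) : R :=
  (expR (- v) * n.+1%:R < k%:R < expR (- u) * n.+1%:R)%R%:R.
pose F n t := (bernstein n.+1 (phi n) (X t) * f t)%:E.
pose G t := ((expR (- v) < X t < expR (- u))%R%:R * f t)%:E.
have phi01 n k : 0 <= phi n k <= 1 by rewrite /phi ler0n lern1 leq_b1.
have intF n : mu.-integrable D (F n).
  have := @integrable_pow_bernstein f n.+1 (phi n) 0 0 intf (phi01 n).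
  by apply: eq_integrable => // t _; rewrite /F /= !mul1r.
have mf : measurable_fun D f by have /measurable_EFinP := measurable_int mu intf.
have GE t : D t -> G t = ((f \_ `]u, v[) t)%:E.
  move=> Dt; rewrite /G /X !ltr_expR !ltrN2 patchE /=.
  have -> : (t \in `]u, v[%classic) = (u < t < v) by rewrite mem_setE in_itv.
  by rewrite andbC; case: ifP => _; rewrite ?mul1r ?mul0r.
have [] := @dominated_convergence _ _ _ mu D mD F G (fun t => `|(f t)%:E|%E).
- by move=> n; exact: measurable_int (intF n).
- apply: eq_measurable_fun (_ : measurable_fun D (EFin \o (f \_ `]u, v[))).
    by move=> t; rewrite inE => /GE ->.
  apply/measurable_EFinP.
  apply: (@measurable_restrict _ _ _ _ `]u, v[%classic D f (measurable_itv _) mD).1.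
  by apply: measurable_funS mf => // t [].
(* Convergence may fail at the jumps [t = u] and [t = v], which form a null set. *)
- have neq (w : R) : {ae mu, forall t, t != w}.
    exists [set w]; split => //; first exact: lebesgue_measure_set1.
    by move=> t /= /negP; rewrite negbK => /eqP.
  have FF := ae_filter_ringOfSetsType mu.
  apply: filterS2 (neq u) (neq v) => t tu tv Dt.
  apply: cvg_EFin; first exact: nearW.
  apply: cvgMr_tmp; apply: bernstein_indic_cvg; first exact: X01.
    by rewrite (inj_eq (@expR_inj R)) (inj_eq oppr_inj).
  by rewrite (inj_eq (@expR_inj R)) (inj_eq oppr_inj).
- exact: integrable_abse.
- apply: nearW => t n Dt; rewrite /F lee_fin normrM ler_piMl//.
  by have /andP[b0 b1] := bernstein_itv01 n.+1 (X01 Dt) (phi01 n); rewrite ger0_norm.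
move=> _ _ cvgF.
have intuv : (\int[mu]_(t in D) G t = \int[mu]_(t in `]u, v[) (f t)%:E)%E.
  rewrite (_ : `]u, v[%classic = D `&` `]u, v[).
    rewrite integral_mkcondr; apply: eq_integral => t; rewrite inE => /GE ->.
    by rewrite restrict_EFin.
  apply/seteqP; split => t /=; last by case.
  by rewrite /D/= !in_itv/= andbT => /andP[ut tv]; rewrite ut tv (le_lt_trans u0).
rewrite intuv in cvgF.
rewrite /Rintegral fine_ge0// -(cvg_lim _ cvgF)//; apply: lime_ge.
  by apply/cvg_ex; eexists; exact: cvgF.
apply: nearW => n; rewrite -[leRHS]fineK; last exact: integrable_fin_num.
have := pow_bernstein_ge0 intf f_ge0 n.+1 (phi01 n) 0 0.
rewrite lee_fin /Rintegral /F; under eq_integral do rewrite !mul1r.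
exact.
Qed.

End Hausdorff.

(** * Almost-everywhere bounds as complete monotonicity of moments *)

Section Moments.
Context {R : realType}.
Local Notation mu := (@lebesgue_measure R).
Implicit Types (w : R -> R) (n m : nat).

Let D : set R := `]0, +oo[%classic.
Let mD : measurable D. Proof. exact: measurable_itv. Qed.

Definition moment w m : R := \int[mu]_(t in D) (expR (- m.+1%:R * t) * w t).

(** Setting one factor [exp (- t)] apart makes [moment w m], the Laplace transform at [s = m + 1],
    the [m]-th power moment in [exp (- t)] of this function, which is integrable for the errors
    considered. *)
Definition weighted w : R -> R := fun t => expR (- t) * w t.

Lemma moment_weighted w n m t :
  expR (- t) ^+ m * (1 - expR (- t)) ^+ n * weighted w t =
  (1 - expR (- t)) ^+ n * (expR (- m.+1%:R * t) * w t).
Proof.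
rewrite /weighted -expRM_natl mulrN -natr1 mulNr mulrDl mul1r opprD expRD; ring.
Qed.

Lemma integrable_pow_weighted w m n : mu.-integrable D (EFin \o weighted w) ->
  mu.-integrable D
    (EFin \o (fun t => expR (- t) ^+ m * (1 - expR (- t)) ^+ n * weighted w t)).
Proof.
move=> intw; have := @integrable_pow_bernstein R _ 0 (fun=> 1) m n intw.
rewrite lexx ler01 => /(_ (fun=> isT)); apply: eq_integrable => // t _ /=.
by rewrite mulr1.
Qed.

Lemma integrable_moment w m : mu.-integrable D (EFin \o weighted w) ->
  mu.-integrable D (EFin \o (fun t => expR (- m.+1%:R * t) * w t)).
Proof.
move=> /(integrable_pow_weighted m 0); apply: eq_integrable => // t _ /=.
by rewrite moment_weighted expr0 mul1r.
Qed.

(** Each difference multiplies the integrand by [1 - exp (- t)]. *)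
Lemma iter_nabla_moment w n m : mu.-integrable D (EFin \o weighted w) ->
  iter n nabla (moment w) m =
  \int[mu]_(t in D) (expR (- t) ^+ m * (1 - expR (- t)) ^+ n * weighted w t).
Proof.
move=> intw; elim: n m => [|n IH] m /=.
  by apply: eq_Rintegral => t _; rewrite moment_weighted expr0 mul1r.
rewrite /nabla !IH -RintegralB//; try exact: integrable_pow_weighted.
by apply: eq_Rintegral => t _; rewrite !exprS; ring.
Qed.

Lemma cm_momentP w : mu.-integrable D (EFin \o weighted w) ->
  cm (moment w) <-> {ae mu, forall t, 0 < t -> 0 <= w t}.
Proof.
move=> intw; have FF := ae_filter_ringOfSetsType mu; split => [cmw|w0].
  have := @hausdorff_ae_ge0 R _ intw => /(_ _)/wrap[].
    by move=> m n; rewrite -iter_nabla_moment.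
  by apply: filterS => t + t0 => /(_ t0); rewrite /weighted pmulr_rge0 ?expR_gt0.
move=> n m; rewrite iter_nabla_moment//.
pose g t := expR (- t) ^+ m * (1 - expR (- t)) ^+ n * weighted w t.
have intg : mu.-integrable D (EFin \o g) := integrable_pow_weighted m n intw.
rewrite /Rintegral (@ae_eq_integral _ _ _ mu D (fun t => `|(g t)%:E|%E))//.
- by rewrite fine_ge0// integral_ge0.
- exact: measurable_int intg.
- by apply: measurableT_comp => //; exact: measurable_int intg.
apply: filterS w0 => t w0 Dt; have t0 : 0 < t by move: Dt; rewrite /D/= in_itv/= andbT.
rewrite /= ger0_norm// mulr_ge0 ?mulr_ge0 ?w0 ?exprn_ge0 ?expR_ge0//.
by rewrite subr_ge0 -expR0 ler_expR oppr_le0 ltW.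
Qed.

(** Obtained from the exponential density [c exp (- c t)], whose total mass is 1. *)
Lemma integrable_Rintegral_expR (c : R) : 0 < c ->
  mu.-integrable D (EFin \o (fun t => expR (- c * t))) /\
  \int[mu]_(t in D) expR (- c * t) = c^-1.
Proof.
move=> c0.
have pdfE t : D t -> expR (- c * t) = c^-1 * exponential_pdf c t.
  rewrite /D/= in_itv/= andbT => t0.
  by rewrite exponential_pdfE ?ltW// mulKf ?gt_eqF.
have intp (A : set R) : measurable A -> mu.-integrable A (EFin \o exponential_pdf c).
  by move=> mA; apply: integrableS (integrable_exponential_pdf c0).
split.
  apply: (@eq_integrable _ _ _ mu D mD (EFin \o (fun t => c^-1 * exponential_pdf c t))).
    by move=> t; rewrite inE => /pdfE /= ->.
  by have := @integrableZl _ _ _ mu D mD c^-1 _ (intp _ mD).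
rewrite (@eq_Rintegral _ _ _ mu D (fun t => c^-1 * exponential_pdf c t)); last first.
  by move=> t; rewrite inE => /pdfE.
rewrite RintegralZl//; last exact: intp.
rewrite Rintegral_itv_obnd_cbnd; last exact: intp.
have := integral_exponential_pdf c0.
rewrite Rintegral_mkcond => H.
rewrite (_ : _ \_ _ = exponential_pdf c); first by rewrite /Rintegral H mulr1.
by apply/funext => t; rewrite /exponential_pdf !patchE; case: ifP => // ->.
Qed.

Lemma integrable_weightedD (M c : R) w : mu.-integrable D (EFin \o weighted w) ->
  mu.-integrable D (EFin \o weighted (fun t => M + c * w t)).
Proof.
move=> intw.
have [inte _] := @integrable_Rintegral_expR 1 ltr01.
have := @integrableD _ _ _ mu D mD _ _ (@integrableZl _ _ _ mu D mD M _ inte)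
  (@integrableZl _ _ _ mu D mD c _ intw).
apply: eq_integrable => // t _; rewrite /weighted /= mulN1r -!EFinM -EFinD.
by congr EFin; ring.
Qed.

Lemma momentD (M c : R) w m : mu.-integrable D (EFin \o weighted w) ->
  moment (fun t => M + c * w t) m = M / m.+1%:R + c * moment w m.
Proof.
move=> intw; have [inte <-] := @integrable_Rintegral_expR m.+1%:R (ltr0Sn _ _).
have intm := integrable_moment m intw.
rewrite /moment -!RintegralZl// -RintegralD//.
- by apply: eq_Rintegral => t _; ring.
- by have := @integrableZl _ _ _ mu D mD M _ inte.
- by have := @integrableZl _ _ _ mu D mD c _ intm.
Qed.

(** [cm_momentP] applied to [M + w] and [M - w]; the constant [M] has moments [M / (m + 1)]. *)
Lemma cm_moment_boundP (M : R) w : mu.-integrable D (EFin \o weighted w) ->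
  (cm (fun m => M / m.+1%:R + moment w m) /\ cm (fun m => M / m.+1%:R - moment w m))
  <-> {ae mu, forall t, 0 < t -> `|w t| <= M}.
Proof.
move=> intw; have FF := ae_filter_ringOfSetsType mu.
have intMw (c : R) := integrable_weightedD M c intw.
have E (c : R) : moment (fun t => M + c * w t) =
    (fun m => M / m.+1%:R + c * moment w m).
  by apply/funext => m; rewrite momentD.
have Ep : moment (fun t => M + 1 * w t) = (fun m => M / m.+1%:R + moment w m).
  by rewrite E; apply/funext => m; rewrite mul1r.
have En : moment (fun t => M + (-1) * w t) = (fun m => M / m.+1%:R - moment w m).
  by rewrite E; apply/funext => m; rewrite mulN1r.
rewrite -Ep -En; split=> [[/(cm_momentP (intMw 1)) cp /(cm_momentP (intMw (-1))) cn]|wM].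
  apply: filterS2 cp cn => t wp wn t0.
  rewrite ler_norml -[_ <= w t]subr_ge0 -[w t <= _]subr_ge0 opprK addrC.
  by move: (wp t0) (wn t0); rewrite mul1r mulN1r => -> ->.
split; apply/(cm_momentP (intMw _)); apply: filterS wM => t + t0 => /(_ t0);
  rewrite ler_norml => /andP[]; lra.
Qed.

End Moments.

(** * Back to the Laplace transform *)

Section RealFrequencies.
Context {R : realType}.
Local Notation mu := (@lebesgue_measure R).
Local Notation Re := complex.Re.
Implicit Types (w : R -> R) (x : R) (z : R[i]%C).

Lemma ReMl x z : Re (x%:C%C * z) = x * Re z.
Proof. by case: z => u v; rewrite /= mul0r subr0. Qed.

Lemma ReD z z' : Re (z + z') = Re z + Re z'.
Proof. by case: z z' => [? ?] [? ?]. Qed.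

Lemma Re_laplace w (s : R) :
  Re (laplace w s%:C%C) = \int[mu]_(t in `]0, +oo[) (expR (- s * t) * w t).
Proof.
rewrite /laplace /cintegral /=; apply: eq_Rintegral => t _.
rewrite /cexp /= !(oppr0, mulr0, mul0r, subr0, addr0) cos0.
by rewrite !(mulr0, mul0r, subr0, addr0, mulr1).
Qed.

Lemma has_laplace_weighted w : has_laplace w ->
  mu.-integrable `]0, +oo[ (EFin \o weighted w).
Proof.
move=> /(_ 1 ltr01); apply: eq_integrable => //.
by move=> t _; rewrite /weighted /= mulN1r.
Qed.

Lemma transformed_heat_resolvent (s l r : R) (u : R -> R[i]%C) :
  transformed_heat s%:C%C l r u -> resolvent s l r (fun=> 0) (fun x => Re (u x)).
Proof.
move=> [[cu _] uE]; split => //.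
exists (fun x => derive1 (fun y => Re (u y)) x) => x xlr.
have [[du _] [ddu _] /(congr1 (@Re R))] := uE x xlr.
rewrite ReMl /= => E; split.
  by rewrite derive1E; exact/derivableP.
by rewrite subr0 E derive1E; exact/derivableP.
Qed.

Lemma Re_diff_quotient (u : R -> R[i]%C) x (y : R) :
  Re (diff_quotient u x y) = (Re (u y) - Re (u x)) / (y - x).
Proof.
rewrite /diff_quotient mulrC -fmorphV ReMl mulrC.
by case: (u y) (u x) => [? ?] [? ?].
Qed.

(** At a real frequency the equations have real coefficients, so real parts solve the same problem.
    The relaxation parameter [1/2] produces the factor 2 in front of [G]. *)
Lemma dnwr_errors_sweep a b (h : nat -> R -> R)
    (u1 u2 : nat -> R[i]%C -> R -> R[i]%C) k :
  dnwr_errors a b 2^-1 h u1 u2 ->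
  sweep a b (moment (h k)) (moment (h k.+1))
    (fun m x => Re (u1 k.+1 m.+1%:R%:C%C x)) (fun m x => Re (u2 k.+1 m.+1%:R%:C%C x)).
Proof.
move=> [_ it] m; have [//|[heat1 u1b u10] heat2 [flux [fl _] [fr _]] u2a hk] :=
  it k m.+1%:R%:C%C.
split.
- by split; exact: transformed_heat_resolvent.
- by rewrite u1b u10 Re_laplace.
- exists (Re flux).
  + rewrite (@eq_cvg _ _ _ _ (fun x => Re (diff_quotient (u1 k.+1 m.+1%:R%:C%C) 0 x))).
      exact: fl.
    by move=> x; rewrite Re_diff_quotient.
  + rewrite (@eq_cvg _ _ _ _ (fun x => Re (diff_quotient (u2 k.+1 m.+1%:R%:C%C) 0 x))).
      exact: fr.
    by move=> x; rewrite Re_diff_quotient.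
- by rewrite u2a.
- have := congr1 (@Re R) hk; rewrite ReD !ReMl !Re_laplace => E.
  by rewrite [moment (h k.+1) m]E /moment; field.
Qed.

(** The induction carries the bound over all [t > 0], since the Laplace transform involves every
    time and not only [t < T]. *)
Lemma dnwr_errors_bound a b (h : nat -> R -> R) u1 u2 (M : R) :
  0 < a -> 0 < b -> 0 <= M -> dnwr_errors a b 2^-1 h u1 u2 ->
  {ae mu, forall t, 0 < t -> `|h 0%N t| <= M} ->
  forall k, {ae mu, forall t, 0 < t -> `|h k t| <= (`|b - a| / (2 * b)) ^+ k * M}.
Proof.
move=> a0 b0 M0 it h0M; have intw k := has_laplace_weighted (it.1 k).
elim=> [|k IH]; first by rewrite expr0 mul1r.
apply/(cm_moment_boundP _ (intw _)); rewrite exprS -mulrA.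
have [cp cn] := (cm_moment_boundP _ (intw _)).2 IH.
have C0 : 0 <= (`|b - a| / (2 * b)) ^+ k * M.
  by rewrite mulr_ge0// exprn_ge0// divr_ge0// mulr_ge0// ltW.
have [] := sweep_contraction a0 b0 C0 (dnwr_errors_sweep k it) cp cn.
by split.
Qed.

(** Settles the case distinction on the total measure in [Lnorm] at exponent [+oo]. *)
Lemma lebesgue_measure_setT_gt0 : (0 < mu [set: R])%E.
Proof.
apply: (@lt_le_trans _ _ (mu `]0%R, 1%R[%classic)).
  by rewrite lebesgue_measure_itv/= lte_fin ltr01 sube0 lte_fin ltr01.
by apply: le_measure => //; rewrite inE.
Qed.

Lemma Linfty_norm_leP (T : R) w (M : R) : 0 <= M ->
  (Linfty_norm T w <= M%:E)%E <-> {ae mu, forall t, `|(w \_ `]0, T[) t| <= M}.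
Proof.
move=> M0; rewrite /Linfty_norm unlock lebesgue_measure_setT_gt0.
by split => [/ess_supP|wM]; [|apply/ess_supP].
Qed.

End RealFrequencies.

Theorem theorem2 (R : realType) (a b T : R) (h0 : R -> R)
    (h : nat -> R -> R) (u1 u2 : nat -> R[i]%C -> R -> R[i]%C)
    (ha : 0 < a) (hb : 0 < b) (hT : 0 < T)
    (h0_Linfty : h0 \_ `]0, T[ \in Lfun lebesgue_measure +oo%E)
    (h_init : h 0%N = h0 \_ `]0, T[)
    (h_iter : dnwr_errors a b 2^-1 h u1 u2) :
  (forall k : nat, (0 < k)%N ->
     (Linfty_norm T (h k) <=
        ((`|b - a| / (2 * b)) ^+ k)%:E * Linfty_norm T h0)%E) /\
  (a < 3 * b -> `|b - a| / (2 * b) < 1).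
Proof.
split=> [k _|ab]; last first.
  rewrite ltr_pdivrMr ?mulr_gt0// mul1r ltr_norml; apply/andP; split; lra.
have C0 : 0 <= (`|b - a| / (2 * b)) ^+ k.
  by rewrite exprn_ge0// divr_ge0// mulr_ge0// ltW.
(* Finiteness allows the norm to be replaced by a real number [M]. *)
have : Linfty_norm T h0 \is a fin_num.
  rewrite ge0_fin_numE ?Lnorm_ge0//.
  by move: h0_Linfty => /sub_Lfun_finLfun; rewrite inE.
move=> /fineK; set M := fine _ => /esym ME.
have M0 : 0 <= M by rewrite fine_ge0// Lnorm_ge0.
have FF := ae_filter_ringOfSetsType (@lebesgue_measure R).
rewrite ME -EFinM; apply/Linfty_norm_leP; first by rewrite mulr_ge0.
(* As [h 0] vanishes outside []0, T[], its bound there is a bound on the half-line. *)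
have h0M : {ae lebesgue_measure, forall t, 0 < t -> `|h 0%N t| <= M}.
  have : (Linfty_norm T h0 <= M%:E)%E by rewrite ME.
  move=> /(Linfty_norm_leP _ _ M0); apply: filterS => t + _.
  by rewrite h_init.
have := dnwr_errors_bound ha hb M0 h_iter h0M k; apply: filterS => t ht.
rewrite patchE; case: ifPn => [|_]; last by rewrite normr0 mulr_ge0.
by rewrite inE/= in_itv/= => /andP[t0 _]; exact: ht.
Qed.
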